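(* Let $S$ be a positive semiring. Then the following statements hold: (1) $1 \in \operatorname{Dns}(S)$. (2) If $s,t \in \operatorname{pcomp}(S)$, $s\leq t$, and $s\in \operatorname{Dns}(S)$, then $t \in \operatorname{Dns}(S)$. If in addition the semiring $S$ is multiplicatively idempotent, then the following hold: (a) If $s \in \operatorname{pcomp}(S)$ and $t \in \operatorname{Dns}(S)$, then $s+t \in \operatorname{Dns}(S)$. (b) If $s, s^* \in \operatorname{pcomp}(S)$, then $s+s^* \in \operatorname{Dns}(S)$. (c) If $s,t,s^*, t^*, s^{**}, t^{**} \in \operatorname{pcomp}(S)$, then $s^{**} + t^{**} \in \operatorname{Dns}(S)$ if and only if $s+t \in \operatorname{Dns}(S)$.
   Context: A semiring is a set $S$ with operations $+,\cdot$ such that $(S,+)$ is a commutative monoid with identity $0$, $(S,\cdot)$ is a commutative monoid with identity $1\neq 0$, multiplication distributes over addition, and $s\cdot 0=0$ for all $s\in S$. It is multiplicatively idempotent if $s^2=s$ for all $s\in S$. An ordered semiring is a semiring with a partial order $\leq$ such that $s\leq t$ implies $s+u\leq t+u$ for all $u$, and $s\leq t$, $0\leq u$ imply $su\leq tu$. It is positive if $0\leq s$ for all $s\in S$. In an ordered semiring $S$, an element $s$ is pseudocomplemented if there is an element $s^*\in S$ (necessarily unique, called the pseudocomplement of $s$) such that $ss^*=0$ and, for each $x\in S$, $sx=0$ implies $x\leq s^*$. $\operatorname{pcomp}(S)$ is the set of pseudocomplemented elements of $S$. Write $s^{**}=(s^* )^*$ when it exists. For $S$ positive, an element $s\in\operatorname{pcomp}(S)$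 is dense if $s^*=0$; $\operatorname{Dns}(S)$ is the set of dense elements of $S$. *)

(* Defs.v *)
From HB Require Import structures.
From mathcomp Require Import all_boot all_order ssralg.
From mathcomp Require Import boolp classical_sets.

Set Implicit Arguments.
Unset Strict Implicit.
Unset Printing Implicit Defensive.

Import Order.TTheory GRing.Theory.
Local Open Scope ring_scope.

(* Semirings are commutative with 1 != 0, i.e. comNzSemiRingType. The ordered
   structures of MathComp all require opposites, hence the ones below. *)
HB.mixin Record ComNzSemiRing_POrder_isOrdered (d : Order.disp_t) S
    of GRing.ComNzSemiRing S & Order.POrder d S := {
  le_sadd2r : forall s t u : S, (s <= t)%O -> (s + u <= t + u)%O ;
  le_smul2r : forall s t u : S, (s <= t)%O -> ((0 : S) <= u)%O ->
    (s * u <= t * u)%O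
}.

#[short(type="orderedSemiRingType")]
HB.structure Definition OrderedSemiRing (d : Order.disp_t) :=
  { S of GRing.ComNzSemiRing S & Order.POrder d S
         & ComNzSemiRing_POrder_isOrdered d S }.

HB.mixin Record OrderedSemiRing_isPositive (d : Order.disp_t) S
    of OrderedSemiRing d S := {
  sring_ge0 : forall s : S, ((0 : S) <= s)%O
}.

#[short(type="positiveSemiRingType")]
HB.structure Definition PositiveSemiRing (d : Order.disp_t) :=
  { S of OrderedSemiRing d S & OrderedSemiRing_isPositive d S }.

Definition multiplicatively_idempotent (S : comNzSemiRingType) : Prop :=
  forall s : S, s ^+ 2 = s.

Section Pseudocomplement.
Variables (d : Order.disp_t) (S : orderedSemiRingType d).

Definition is_pcompl (s c : S) : Prop :=
  s * c = 0 /\ forall x : S, s * x = 0 -> (x <= c)%O.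

Lemma is_pcompl_unique (s c c' : S) : is_pcompl s c -> is_pcompl s c' -> c = c'.
Proof.
by move=> [sc cmax] [sc' c'max]; apply/le_anti; rewrite c'max// cmax.
Qed.

Definition PComp : set S := [set s | exists c, is_pcompl s c].

(* Junk value 0 when s is not pseudocomplemented: s^* = 0 is meaningful only
   together with s \in PComp. *)
Definition pcompl (s : S) : S := xget 0 [set c | is_pcompl s c].

Lemma pcomplP (s : S) : s \in PComp -> is_pcompl s (pcompl s).
Proof. by rewrite in_setE => sP; exact: (@xgetPex _ 0 (is_pcompl s)). Qed.

Lemma pcomplE (s c : S) : is_pcompl s c -> pcompl s = c.
Proof.
move=> sc; have sP : s \in PComp by rewrite in_setE; exists c.
exact: is_pcompl_unique (pcomplP sP) sc.
Qed.

End Pseudocomplement.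

Arguments PComp {d} S.

Definition Dns (d : Order.disp_t) (S : positiveSemiRingType d) : set S :=
  [set s | s \in PComp S /\ pcompl s = 0].

Arguments Dns {d} S.

(* Main.v *)
(* In a positive semiring [a + b = 0] forces [a = b = 0], so the annihilator of a
   sum is the intersection of the annihilators. Since [s] is dense iff its
   annihilator is [{0}], and since [s] and [s^**] have the same annihilator, every
   claim becomes a statement about annihilators. For (b), an [x] killing both [s]
   and [s^*] satisfies [x <= s^*], so [x = x ^+ 2 <= s^* * x = 0]. *)
Require Import Defs.
From mathcomp Require Import all_boot all_order ssralg.
From mathcomp Require Import boolp classical_sets.

Import Order.TTheory GRing.Theory.
Local Open Scope ring_scope.

Section PositiveSemiRingTheory.
Set Implicit Arguments.
Unset Strict Implicit.
Context {d : Order.disp_t} {S : positiveSemiRingType d}.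
Implicit Types s t x y : S.

Lemma sring_le0_eq0 x : (x <= 0)%O -> x = 0.
Proof. by move=> x_le0; apply/le_anti; rewrite x_le0 sring_ge0. Qed.

(** Adding [x] to [0 <= y] gives [x <= x + y = 0]. *)
Lemma sring_addr_eq0l x y : x + y = 0 -> x = 0.
Proof.
move=> xy0; apply: sring_le0_eq0; rewrite -xy0 addrC -[leLHS]add0r.
by apply: le_sadd2r; apply: sring_ge0.
Qed.

Lemma sring_addr_eq0 x y : x + y = 0 <-> x = 0 /\ y = 0.
Proof.
split=> [xy0 | [-> ->]]; last by rewrite addr0.
by split; [move: xy0 | move: xy0; rewrite addrC]; apply: sring_addr_eq0l.
Qed.

Lemma sring_le_mul_eq0 s t x : (s <= t)%O -> t * x = 0 -> s * x = 0.
Proof.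
move=> st tx0; apply: sring_le0_eq0; rewrite -tx0.
by apply: le_smul2r => //; apply: sring_ge0.
Qed.

(** A trivial annihilator makes [0] itself a pseudocomplement of [s], so membership in [PComp S]
    comes for free and never has to be proved for sums. *)
Lemma DnsP s : s \in Dns S <-> forall x, s * x = 0 -> x = 0.
Proof.
rewrite in_setE; split=> [[sP s0] x sx0 | ann0].
  have [_] := pcomplP sP; rewrite s0 => s_max.
  exact/sring_le0_eq0/s_max.
have s0 : is_pcompl s 0 by split=> [|x /ann0 ->]; rewrite ?mulr0.
by split; [rewrite in_setE; exists 0 | exact: pcomplE].
Qed.

(** Forwards, [s] kills [pcompl s], hence lies below its double pseudocomplement. Backwards,
    [s * x = 0] gives [x <= pcompl s], which [pcompl (pcompl s)] kills. *)
Lemma pcompl_pcompl_mul_eq0 s x : s \in PComp S -> pcompl s \in PComp S ->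
  pcompl (pcompl s) * x = 0 <-> s * x = 0.
Proof.
move=> /pcomplP[ss' s'max] /pcomplP[s's'' s''max]; split.
  by apply: sring_le_mul_eq0; apply: s''max; rewrite mulrC.
by move=> /s'max xs'; rewrite mulrC; apply: sring_le_mul_eq0 xs' s's''.
Qed.

End PositiveSemiRingTheory.

Theorem proposition2p20 (d : Order.disp_t) (S : positiveSemiRingType d) :
  [/\ (1 : S) \in Dns S,
      (forall s t : S, s \in PComp S -> t \in PComp S -> (s <= t)%O ->
         s \in Dns S -> t \in Dns S)
    & multiplicatively_idempotent S ->
      [/\ (forall s t : S, s \in PComp S -> t \in Dns S -> s + t \in Dns S),
          (forall s : S, s \in PComp S -> pcompl s \in PComp S ->
             s + pcompl s \in Dns S)
        & (forall s t : S,
             s \in PComp S -> t \in PComp S ->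
             pcompl s \in PComp S -> pcompl t \in PComp S ->
             pcompl (pcompl s) \in PComp S -> pcompl (pcompl t) \in PComp S ->
             (pcompl (pcompl s) + pcompl (pcompl t) \in Dns S <->
              s + t \in Dns S))]].
Proof.
split=> [|s t _ _ st /DnsP sD|idem].
- by apply/DnsP => x; rewrite mul1r.
(* Annihilators shrink as elements grow, so density passes upwards. *)
- by apply/DnsP => x /(sring_le_mul_eq0 st)/sD.
split=> [s t _ /DnsP tD|s sP _|s t sP tP s'P t'P _ _].
- by apply/DnsP => x; rewrite mulrDl => /sring_addr_eq0[_ /tD].
- apply/DnsP => x; rewrite mulrDl => /sring_addr_eq0[sx0 s'x0].
  rewrite -[x]idem expr2; apply: sring_le_mul_eq0 s'x0.
  by have [_ s_max] := pcomplP sP; apply: s_max.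
- have annE x : (pcompl (pcompl s) + pcompl (pcompl t)) * x = 0 <->
      (s + t) * x = 0.
    by rewrite !mulrDl !sring_addr_eq0 !pcompl_pcompl_mul_eq0.
  by split=> /DnsP D; apply/DnsP => x /annE/D.
Qed.
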